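(* Let $T$ be a tree rooted at $o$ and let $\psi:T\to\mathbb{C}$ be such that $M_\psi$ is a bounded multiplication operator on $\mathcal{L}_{\mathbf{w}}$. Then the following statements are equivalent. (a) $M_\psi$ is compact on $\mathcal{L}_{\mathbf{w}}$. (b) $M_\psi$ is compact on $\mathcal{L}_{\mathbf{w},0}$. (c) $\lim_{|v|\to\infty}\psi(v)=0$ and $\lim_{|v|\to\infty}|v|\log|v|\,D\psi(v)=0$.
   Context: A tree $T$ is a locally finite, connected, simply-connected graph, identified with its set of vertices; $T$ is assumed to have no terminal vertices (vertices with exactly one neighbor), so it is infinite, and it is rooted at a vertex $o$. $|v|$ is the number of edges in the unique path from $o$ to $v$; $T^*=T\setminus\{o\}$; for $v\in T^*$, $v^-$ is the neighbor of $v$ closest to $o$. For $f:T\to\mathbb{C}$ and $v\in T^*$, $Df(v)=|f(v)-f(v^-)|$. The weighted Lipschitz space $\mathcal{L}_{\mathbf{w}}$ is the set of $f:T\to\mathbb{C}$ with $\sup_{v\in T^*}|v|Df(v)<\infty$, normed by $\|f\|_{\mathbf{w}}=|f(o)|+\sup_{v\in T^*}|v|Df(v)$ (a Banach space). The little weighted Lipschitz space $\mathcal{L}_{\mathbf{w},0}$ is the closed subspace of those $f\in\mathcal{L}_{\mathbf{w}}$ with $\lim_{|v|\to\infty}|v|Df(v)=0$. $M_\psi f=\psi f$ (pointwise product); ''$M_\psi$ is bounded on $X$'' means $M_\psi$ maps $X$ into $X$ and is a bounded linear operator there. It is known that $M_\psi$ is bounded on $\mathcal{L}_{\mathbf{w}}$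 if and only if it is bounded on $\mathcal{L}_{\mathbf{w},0}$. *)

(* Defs.v *)
From HB Require Import structures.
From mathcomp Require Import all_boot all_order all_algebra.
From mathcomp Require Import all_classical all_reals all_analysis.
From mathcomp Require Import complex.

Set Implicit Arguments.
Unset Strict Implicit.
Unset Printing Implicit Defensive.

Import Order.TTheory GRing.Theory Num.Theory.
Import numFieldNormedType.Exports.

Local Open Scope classical_set_scope.
Local Open Scope ring_scope.
Local Open Scope complex_scope.

HB.instance Definition _ (R : realType) := NormedModule.copy R[i] R[i]^o.

(* [tree_infinite] only excludes the graph with a single isolated vertex, which
   has no vertex with exactly one neighbor either. *)
Record rooted_tree := RootedTree {
  vertex :> choiceType;
  adj : rel vertex;
  root : vertex;
  adj_sym : symmetric adj;
  adj_irrefl : irreflexive adj;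
  tree_locally_finite : forall u, finite_set [set v | adj u v];
  tree_connected : forall u v, exists2 p, path adj u p & last u p = v;
  tree_simply_connected : forall c : seq vertex, ucycle adj c -> (size c < 3)%N;
  tree_no_terminal : forall u, ~ exists v, [set w | adj u w] = [set v];
  tree_infinite : infinite_set [set: vertex]
}.
Arguments adj {r} _ _.
Arguments root {r}.

Section Tree.
Variable T : rooted_tree.
Implicit Types (u v w : T) (p q : seq T).

Definition is_root_path v p :=
  [/\ path adj root p, uniq (root :: p) & last root p = v].

(* The path from the root to [v], without its first vertex [root], so that its
   size is the number of edges. *)
Definition root_path v : seq T := xget [::] (is_root_path v).

Definition depth v : nat := size (root_path v).

(* Only meaningful for [v != root]. *)
Definition parent v : T :=
  xget root [set u | adj v u /\ forall w, adj v w -> (depth u <= depth w)%N].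

(* The filter of |v| -> oo. *)
Definition at_infty : set_system T :=
  filter_from [set: nat] (fun N => [set v | (N <= depth v)%N]).

Global Instance at_infty_filter : Filter at_infty.
Proof.
apply: filter_from_filter; first by exists 0%N.
move=> m n _ _; exists (maxn m n) => // v /=.
by rewrite geq_max => /andP.
Qed.

Lemma simple_path_unique u p q :
  path adj u p -> uniq (u :: p) -> path adj u q -> uniq (u :: q) ->
  last u p = last u q -> p = q.
Proof.
elim: p u q => [|a p IH] u [|b q] //.
- by move=> _ _ _ /andP[/negP + _] e; case; rewrite (e : u = last b q) mem_last.
- by move=> _ /andP[/negP + _] _ _ e; case; rewrite -(e : last a p = u) mem_last.
have [<-|ab] := eqVneq a b.
  move=> /= /andP[_ pp] /andP[_ up] /andP[_ pq] /andP[_ uq] e.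
  by congr cons; exact: (IH a).
move=> pp up pq uq e; exfalso.
have hs : has (mem (b :: q)) (a :: p).
  apply/hasP; exists (last a p); first exact: mem_last.
  by rewrite inE; move: e => /= ->; exact: mem_last.
have [s1 [z [s2 [apE zq nh]]]] : exists s1 z s2,
    [/\ a :: p = rcons s1 z ++ s2, z \in b :: q & ~~ has (mem (b :: q)) s1].
  by case: (split_find hs) => z s1 s2 zq nh; exists s1, z, s2.
have [t1 [t2 bqE]] : exists t1 t2, b :: q = rcons t1 z ++ t2.
  by case: (path.splitP zq) => t1 t2; exists t1, t2.
rewrite apE in pp up; rewrite bqE in pq uq nh.
have /tree_simply_connected : ucycle adj (u :: rcons s1 z ++ rev t1).
  apply/andP; split.
    rewrite /cycle rcons_cat cat_path last_rcons.
    apply/andP; split; first by move: pp; rewrite cat_path => /andP[].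
    move: pq; rewrite cat_path => /andP[+ _].
    rewrite -(eq_path (fun x y => @adj_sym T y x)) -rev_path.
    by rewrite last_rcons belast_rcons rev_cons.
  move: up uq; rewrite !cons_uniq !mem_cat !negb_or !cat_uniq.
  rewrite mem_rev rev_uniq.
  move=> /and3P[/andP[-> _] -> _] /and3P[/andP[+ _] + _] /=.
  rewrite mem_rcons inE negb_or rcons_uniq => /andP[_ ->] /andP[zt ->].
  rewrite andbT; apply/hasPn => x /=; rewrite mem_rev => xt.
  rewrite mem_rcons inE negb_or; apply/andP; split.
    by apply: contraNneq zt => <-.
  apply: contra nh => xs; apply/hasP; exists x => //=.
  by rewrite mem_cat mem_rcons inE xt orbT.
rewrite /= size_cat size_rcons size_rev.
case: s1 apE {nh pp up} => [|? ?] [az _]; case: t1 bqE {pq uq} => [|? ?] [bz _] //=.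
by rewrite az bz eqxx in ab.
Qed.

Lemma root_pathP v : is_root_path v (root_path v).
Proof.
have [p pp <-] := tree_connected root v.
case/shortenP: pp => q pq uq _; apply: (@xgetPex _ [::] (is_root_path _)).
by exists q.
Qed.

Lemma root_path_unique v p : is_root_path v p -> root_path v = p.
Proof.
have [pv uv lv] := root_pathP v => -[pp up lp].
by apply: (simple_path_unique pv uv pp up); rewrite lv lp.
Qed.

Lemma parentP v : v != root ->
  adj v (parent v) /\ (depth (parent v) < depth v)%N.
Proof.
move=> vr; have [pv uv lv] := root_pathP v.
have [u avu duv] : exists2 u, adj v u & depth v = (depth u).+1.
  rewrite /depth; case/lastP: (root_path v) pv uv lv => [_ _ /= e|p w].
    by rewrite e eqxx in vr.
  rewrite rcons_path last_rcons -rcons_cons rcons_uniq.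
  move=> /andP[pp aw] /andP[_ up] wv; subst w.
  exists (last root p); first by rewrite adj_sym.
  by rewrite size_rcons (@root_path_unique _ p).
have ex : exists n, `[< exists2 w, adj v w & depth w = n >].
  by exists (depth u); apply/asboolP; exists u.
have [ap pmin] : [set u | adj v u /\
    forall w, adj v w -> (depth u <= depth w)%N] (parent v).
  case: (ex_minnP ex) => n /asboolP[w avw dw] nmin.
  apply: (@xgetPex _ root [set u | adj v u /\ forall w, adj v w -> (depth u <= depth w)%N]).
  exists w; split => // w' avw'; rewrite dw; apply: nmin.
  by apply/asboolP; exists w'.
by split=> //; rewrite duv ltnS; exact: pmin.
Qed.

Lemma exists_nonroot : exists v : T, v != root.
Proof.
apply: contrapT => /forallNP h; apply: (@tree_infinite T).
suff -> : [set: T] = [set root] by exact: finite_set1.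
by apply/seteqP; split=> v _ //=; have /negP/negPn/eqP := h v.
Qed.

End Tree.
Arguments at_infty T : clear implicits.

Section WeightedLipschitz.
Variables (R : realType) (T : rooted_tree).
Implicit Types (f g : T -> R[i]) (v : T).

Definition vdiff f v : R := Normc.normc (f v - f (parent v)).

Definition wvdiff f v : R := (depth v)%:R * vdiff f v.

Definition wvdiffs f : set R := [set wvdiff f v | v in [set v | v != root]].

Definition wnorm f : R := Normc.normc (f root) + sup (wvdiffs f).

Lemma wvdiff_ge0 f v : 0 <= wvdiff f v.
Proof. by apply: mulr_ge0 => //; rewrite -lecR; exact: (@normr_ge0 _ R[i]). Qed.

Lemma wvdiffs_nonempty f : wvdiffs f !=set0.
Proof. by have [v vr] := exists_nonroot T; exists (wvdiff f v), v. Qed.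

Lemma wvdiffD f g v : wvdiff (f + g) v <= wvdiff f v + wvdiff g v.
Proof.
rewrite /wvdiff -mulrDr ler_wpM2l// /vdiff.
have -> : (f + g) v - (f + g) (parent v) =
  (f v - f (parent v)) + (g v - g (parent v)) by rewrite opprD addrACA.
exact: le_normcD.
Qed.

Lemma wvdiffZ (a : R[i]) f v : wvdiff (a *: f) v = Normc.normc a * wvdiff f v.
Proof.
rewrite /wvdiff /vdiff mulrCA -Normc.normcM mulrBr.
by rewrite /= /GRing.scale/=.
Qed.

Lemma wvdiff0 v : wvdiff 0 v = 0.
Proof. by rewrite /wvdiff /vdiff subrr Normc.normc0 mulr0. Qed.

Definition Lw_pred : {pred T -> R[i]} :=
  [pred f | `[< has_ubound (wvdiffs f) >]].

Lemma Lw_submod_closed : submod_closed Lw_pred.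
Proof.
split; first by apply/asboolP; exists 0 => _ [v _ <-]; rewrite wvdiff0.
move=> a f g /asboolP[F hF] /asboolP[G hG]; apply/asboolP.
exists (Normc.normc a * F + G) => _ [v vr <-].
rewrite (le_trans (wvdiffD _ _ _))// wvdiffZ lerD//; last by apply: hG; exists v.
rewrite ler_wpM2l//; first by rewrite -lecR; exact: (@normr_ge0 _ R[i]).
by apply: hF; exists v.
Qed.

HB.instance Definition _ :=
  GRing.isSubmodClosed.Build R[i] (T -> R[i]) Lw_pred Lw_submod_closed.

Record Lw := MkLw { Lw_val :> T -> R[i]; _ : Lw_val \in Lw_pred }.

HB.instance Definition _ := [isSub of Lw for Lw_val].
HB.instance Definition _ := [Choice of Lw by <:].
HB.instance Definition _ := [SubChoice_isSubLmodule of Lw by <:].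

Lemma Lw_has_sup (f : Lw) : has_sup (wvdiffs f).
Proof. by split; [exact: wvdiffs_nonempty | case: f => f /= /asboolP]. Qed.

Lemma wvdiff_le_sup (f : Lw) v : v != root -> wvdiff f v <= sup (wvdiffs f).
Proof. by move=> vr; apply: (ub_le_sup (Lw_has_sup f).2); exists v. Qed.

Lemma sup_wvdiffs_ge0 (f : Lw) : 0 <= sup (wvdiffs f).
Proof.
have [v vr] := exists_nonroot T.
exact: le_trans (wvdiff_ge0 f v) (wvdiff_le_sup f vr).
Qed.

Let normc_ge0 (z : R[i]) : 0 <= Normc.normc z.
Proof. by rewrite -lecR; exact: (@normr_ge0 _ R[i]). Qed.

(* Over the scalar field [R[i]] the library's norms take values in [R[i]], hence
   the embedding of the real number [wnorm f]. *)
Let Lw_norm (f : Lw) : R[i] := (wnorm f)%:C.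

Let Lw_normD (f g : Lw) : Lw_norm (f + g) <= Lw_norm f + Lw_norm g.
Proof.
rewrite /Lw_norm -rmorphD lecR /wnorm addrACA lerD//; first exact: le_normcD.
apply: ge_sup => [|_ [v vr <-]]; first exact: wvdiffs_nonempty.
by rewrite (le_trans (wvdiffD _ _ _))// lerD// wvdiff_le_sup.
Qed.

Let Lw_normZ (a : R[i]) (f : Lw) : Lw_norm (a *: f) = `|a| * Lw_norm f.
Proof.
rewrite /Lw_norm -[`|a|]/((Normc.normc a)%:C) -rmorphM; congr (_%:C).
rewrite /wnorm mulrDr -Normc.normcM; congr (_ + _).
have le b (g : Lw) : sup (wvdiffs (b *: g : Lw)) <= Normc.normc b * sup (wvdiffs g).
  apply: ge_sup => [|_ [v vr <-]]; first exact: wvdiffs_nonempty.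
  by rewrite wvdiffZ ler_wpM2l// wvdiff_le_sup.
apply/eqP; rewrite eq_le le/=; have [->|a0] := eqVneq a 0.
  rewrite Normc.normc0 mul0r; exact: (sup_wvdiffs_ge0 (0 *: f : Lw)).
have na0 : 0 < Normc.normc a.
  by rewrite lt_neqAle normc_ge0 andbT eq_sym; apply: contra_neq a0 => /Normc.eq0_normc.
have := le a^-1 (a *: f); rewrite scalerA mulVf// scale1r Normc.normcV => h.
by rewrite mulrC -ler_pdivlMr// mulrC.
Qed.

Let Lw_norm0_eq0 (f : Lw) : Lw_norm f = 0 -> f = 0.
Proof.
rewrite /Lw_norm => /complexI/eqP; rewrite paddr_eq0 ?sup_wvdiffs_ge0//.
move=> /andP[/eqP/Normc.eq0_normc fr /eqP supf].
apply/val_inj/funext => v; move: {2}(depth v) (leqnn (depth v)) => n.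
elim: n v => [|n IH] v; have [->//|vr] := eqVneq v root;
  have [_ ltv] := parentP vr => len; first by move: (leq_trans ltv len).
have fp : f (parent v) = 0 by apply: IH; rewrite -ltnS (leq_trans ltv).
apply: Normc.eq0_normc; apply/eqP; rewrite -[\val f v]subr0 -fp.
rewrite eq_le normc_ge0 andbT.
have dv : 0 < (depth v)%:R :> R by rewrite ltr0n (leq_trans _ ltv).
by rewrite -(pmulr_rle0 _ dv) -supf; exact: wvdiff_le_sup.
Qed.

HB.instance Definition _ :=
  Lmodule_isNormed.Build R[i] Lw Lw_normD Lw_normZ Lw_norm0_eq0.

Lemma Lw_normE (f : Lw) : `|f| = (wnorm f)%:C :> R[i]. Proof. by []. Qed.

Definition Lw0_pred : {pred Lw} :=
  [pred f : Lw | `[< wvdiff f v @[v --> at_infty T] --> (0 : R) >]].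

Lemma Lw0_submod_closed : submod_closed Lw0_pred.
Proof.
split.
  apply/asboolP; rewrite (_ : wvdiff _ = cst 0); first exact: cvg_cst.
  by apply/funext => v; rewrite wvdiff0.
move=> a f g /asboolP f0 /asboolP g0; apply/asboolP.
have h0 : Normc.normc a * wvdiff f v + wvdiff g v @[v --> at_infty T] --> (0 : R).
  rewrite -[0 in X in _ --> X](addr0 0) -[0 in X in _ --> X + _](mulr0 (Normc.normc a)).
  by apply: cvgD g0; apply: cvgM f0; exact: cvg_cst.
apply: (squeeze_cvgr _ (cvg_cst 0) h0); apply: nearW => v.
by rewrite wvdiff_ge0 (le_trans (wvdiffD _ _ _))// wvdiffZ.
Qed.

HB.instance Definition _ :=
  GRing.isSubmodClosed.Build R[i] Lw Lw0_pred Lw0_submod_closed.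

Record Lw0 := MkLw0 { Lw0_val :> Lw; _ : Lw0_val \in Lw0_pred }.

HB.instance Definition _ := [isSub of Lw0 for Lw0_val].
HB.instance Definition _ := [Choice of Lw0 by <:].
HB.instance Definition _ := [SubChoice_isSubLmodule of Lw0 by <:].

Let Lw0_norm (f : Lw0) : R[i] := `|val f|.

Let Lw0_normD (f g : Lw0) : Lw0_norm (f + g) <= Lw0_norm f + Lw0_norm g.
Proof. exact: ler_normD. Qed.

Let Lw0_normZ (a : R[i]) (f : Lw0) : Lw0_norm (a *: f) = `|a| * Lw0_norm f.
Proof. exact: normrZ. Qed.

Let Lw0_norm0_eq0 (f : Lw0) : Lw0_norm f = 0 -> f = 0.
Proof. by move=> /normr0_eq0 f0; exact: val_inj. Qed.

HB.instance Definition _ :=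
  Lmodule_isNormed.Build R[i] Lw0 Lw0_normD Lw0_normZ Lw0_norm0_eq0.

Lemma Lw0_normE (f : Lw0) : `|f| = `|val f| :> R[i]. Proof. by []. Qed.

End WeightedLipschitz.

Section Operators.
Variables (K : numFieldType) (X Y : normedModType K).

Definition bounded_operator (A : {linear X -> Y}) : Prop :=
  exists M : K, forall x, `|A x| <= M * `|x|.

Definition compact_operator (A : {linear X -> Y}) : Prop :=
  forall B : set X, bounded_set B -> precompact (A @` B).

End Operators.

(* [X] is a space of functions on [T], [ev] its embedding into all functions
   [T -> R[i]].  The existence of [A] says that multiplication by [psi] maps [X]
   into [X]. *)
Section MultiplicationOperator.
Variables (R : realType) (T : rooted_tree) (psi : T -> R[i]).
Variables (X : normedModType R[i]) (ev : X -> T -> R[i]).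

Definition is_mult_operator (A : X -> X) : Prop :=
  forall f v, ev (A f) v = psi v * ev f v.

Definition mult_bounded : Prop :=
  exists2 A : {linear X -> X}, is_mult_operator A & bounded_operator A.

Definition mult_compact : Prop :=
  exists2 A : {linear X -> X}, is_mult_operator A & compact_operator A.

End MultiplicationOperator.

Section MultiplicationOperatorOnLw.
Variables (R : realType) (T : rooted_tree) (psi : T -> R[i]).

Definition mult_bounded_Lw := mult_bounded psi (@Lw_val R T).
Definition mult_compact_Lw := mult_compact psi (@Lw_val R T).
Definition mult_compact_Lw0 :=
  mult_compact psi (fun f : Lw0 R T => Lw_val (Lw0_val f)).

End MultiplicationOperatorOnLw.

(* Main.v *)
Require Import Defs.
From HB Require Import structures.
From mathcomp Require Import all_boot all_order all_algebra.
From mathcomp Require Import all_classical all_reals all_analysis.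
From mathcomp Require Import complex ring lra zify.

(** Every [f] in [Lw] satisfies [|f v| <= (2 + ln |v|) * ||f||], so the product
    rule bounds [|v| D(psi f)(v)] by [w(v) * ||f||] with
    [w(v) = |psi (v^-)| + |v| (2 + ln |v|) Dpsi(v)].  Under (c) this weight tends
    to 0, hence [M_psi] maps [Lw] into [Lw0], and it sends a ball into a set of
    functions [g] with [|g v| <= c v] and [|v| Dg(v) <= m * w(v)].  Such a set is
    compact: an ultrafilter on it converges pointwise, and pointwise convergence
    is norm convergence because the tails are uniformly small and balls of the
    tree are finite.

    Conversely (a) and (b) both make [M_psi : Lw0 -> Lw] compact, and a compact
    [M_psi] sends bounded families tending pointwise to 0 to families tending to
    0 in norm.  Normalised indicators of vertices then give [psi -> 0], and the
    functions [w |-> ln(min(|w|, |v|))^2 / ln |v|] give the condition on [Dpsi]. *)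

Set Implicit Arguments.
Unset Strict Implicit.
Unset Printing Implicit Defensive.

Import Order.TTheory GRing.Theory Num.Theory.
Import numFieldNormedType.Exports.
Import Normc.

Local Open Scope classical_set_scope.
Local Open Scope ring_scope.
Local Open Scope complex_scope.

Local Notation root := Defs.root.

(** * Modulus of complex numbers and convergence over [R[i]] *)

Section ComplexModulus.
Variable R : realType.
Implicit Types z : R[i].

Lemma normc_ge0 z : 0 <= normc z.
Proof. by rewrite -lecR; exact: (@normr_ge0 _ R[i]). Qed.

Lemma normc_real (x : R) : normc x%:C = `|x|.
Proof. by rewrite /normc /= expr0n /= addr0 sqrtr_sqr. Qed.

Lemma normc_le_ReIm z : normc z <= `|complex.Re z| + `|complex.Im z|.
Proof.
rewrite -ler_sqr ?nnegrE ?normc_ge0 ?addr_ge0 //.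
case: z => a b /=; rewrite sqr_sqrtr ?addr_ge0 ?sqr_ge0// sqrrD.
by rewrite !real_normK ?num_real// lerD2r lerDl mulrn_wge0// mulr_ge0.
Qed.

Lemma Re_le_normc z : `|complex.Re z| <= normc z.
Proof. by rewrite -lecR; exact: normc_ge_Re. Qed.

Lemma Im_le_normc z : `|complex.Im z| <= normc z.
Proof.
case: z => a b /=; rewrite -sqrtr_sqr ler_sqrt ?addr_ge0 ?sqr_ge0//.
by rewrite lerDr sqr_ge0.
Qed.

(** The positive elements of [R[i]] are exactly the embedded positive reals, so real radii
    suffice. *)
Lemma cvgc_distP (V : normedModType R[i]) (S : Type) (F : set_system S)
    (FF : Filter F) (f : S -> V) (l : V) :
  f @ F --> l <->
  forall e : R, 0 < e -> \forall t \near F, `|l - f t| < e%:C.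
Proof.
split=> [/cvgrPdist_lt h e e0|h]; first by apply: h; rewrite ltcR.
apply/cvgrPdist_lt => -[a b]; rewrite ltcE/= => /andP[/eqP -> a0].
exact: h.
Qed.

Lemma cvg_normc (S : Type) (F : set_system S) (FF : Filter F) (f : S -> R[i]) :
  f @ F --> (0 : R[i]) <-> (fun t => normc (f t)) @ F --> (0 : R).
Proof.
split=> [/cvgc_distP h|/cvgr0Pnorm_lt h].
  apply/cvgr0Pnorm_lt => e /h; apply: filterS => t.
  by rewrite sub0r normrN ltcR (ger0_norm (normc_ge0 _)).
apply/cvgc_distP => e /h; apply: filterS => t.
by rewrite sub0r normrN ltcR (ger0_norm (normc_ge0 _)).
Qed.

End ComplexModulus.

(** * Depth, parents and balls of the tree *)

Section Depth.
Variable T : rooted_tree.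
Implicit Types u v : T.

(** Appending [v] to the root path of [u] gives a walk to [v]; cutting its loops only shortens it
    and leaves the root path of [v]. *)
Lemma depth_adj u v : adj u v -> (depth v <= (depth u).+1)%N.
Proof.
move=> auv; have [pu _ lu] := root_pathP u.
have pv : path adj root (rcons (root_path u) v) by rewrite rcons_path pu lu.
have := last_rcons root (root_path u) v.
have : (size (rcons (root_path u) v) <= (depth u).+1)%N by rewrite size_rcons.
case/shortenP: pv => q pq uq sub szq lq.
rewrite {1}/depth (@root_path_unique _ _ q)//.
apply: leq_trans szq; apply: uniq_leq_size => //.
by case/andP: uq.
Qed.

Lemma depth_parent v : v != root -> depth v = (depth (parent v)).+1.
Proof.
move=> vr; have [avp lt_pv] := parentP vr.
by apply/eqP; rewrite eqn_leq lt_pv andbT depth_adj// adj_sym.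
Qed.

Lemma parent_neq v : v != root -> parent v != v.
Proof. by move=> /parentP[_]; apply: contraTneq => ->; rewrite ltnn. Qed.

Lemma depth_root : depth (root : T) = 0%N.
Proof. by rewrite /depth (@root_path_unique _ _ [::]). Qed.

Lemma depth_gt0 v : (0 < depth v)%N = (v != root).
Proof.
have [->|vr] := eqVneq v root; first by rewrite depth_root.
by rewrite depth_parent.
Qed.

Lemma depth_ind (P : T -> Prop) :
  P root -> (forall v, v != root -> P (parent v) -> P v) -> forall v, P v.
Proof.
move=> P0 PS v; move: {2}(depth v) (erefl (depth v)) => n.
elim: n v => [|n IH] v dv; have [->//|vr] := eqVneq v root.
  by move: vr; rewrite -depth_gt0 dv.
by apply: PS => //; apply: IH; move: dv; rewrite depth_parent// => -[].
Qed.

Lemma finite_depth_le n : finite_set [set v : T | (depth v <= n)%N].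
Proof.
elim: n => [|n IH].
  apply: sub_finite_set (finite_set1 (root : T)) => v /=.
  by rewrite leqNgt depth_gt0 negbK => /eqP.
have fU : finite_set
    (root |` \bigcup_(u in [set v : T | (depth v <= n)%N]) [set w | adj u w]).
  rewrite finite_setU; split; first exact: finite_set1.
  by apply: bigcup_finite => // u _; exact: tree_locally_finite.
apply: sub_finite_set fU => v /= dv.
have [->|vr] := eqVneq v root; [by left|right].
exists (parent v); first by move: dv; rewrite /= depth_parent.
by rewrite /= adj_sym; exact: (parentP vr).1.
Qed.

Lemma at_infty_depth n : \forall v \near at_infty T, (n <= depth v)%N.
Proof. by exists n. Qed.

Lemma at_infty_neq_root : \forall v \near at_infty T, v != root.
Proof. by apply: filterS (at_infty_depth 1) => v; rewrite depth_gt0. Qed.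

Lemma at_infty_parent (P : set T) :
  (\forall v \near at_infty T, P v) ->
  \forall v \near at_infty T, P (parent v).
Proof.
move=> [n _ nP]; exists n.+1 => // v /= nv; apply: nP => /=.
by rewrite -ltnS -depth_parent// -depth_gt0; exact: leq_trans nv.
Qed.

End Depth.

(** * Growth of functions in [Lw] *)

Section LwFacts.
Variables (R : realType) (T : rooted_tree).
Implicit Types (f g : T -> R[i]) (v : T).

Lemma wvdiff_root f : wvdiff f root = 0.
Proof. by rewrite /wvdiff depth_root mul0r. Qed.

Lemma Lw_predP f M : (forall v, wvdiff f v <= M) -> f \in @Lw_pred R T.
Proof. by move=> fM; apply/asboolP; exists M => _ [v _ <-]. Qed.

Lemma sup_wvdiffs_le f M : (forall v, wvdiff f v <= M) -> sup (wvdiffs f) <= M.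
Proof.
by move=> fM; apply: ge_sup; [exact: wvdiffs_nonempty | move=> _ [v _ <-]].
Qed.

Lemma wvdiff_le_wnorm (f : Lw R T) v : wvdiff f v <= wnorm f.
Proof.
have [->|vr] := eqVneq v root.
  by rewrite wvdiff_root addr_ge0 ?normc_ge0 ?sup_wvdiffs_ge0.
by rewrite (le_trans (wvdiff_le_sup f vr))// lerDr normc_ge0.
Qed.

Lemma wnorm_ge0 (f : Lw R T) : 0 <= wnorm f.
Proof. exact: le_trans (wvdiff_ge0 f root) (wvdiff_le_wnorm f root). Qed.

(** This is [ln (1 + x) <= x] at [x = - 1 / (n + 2)]. *)
Lemma ln_succ_ge (n : nat) : n.+2%:R^-1 <= ln n.+2%:R - ln n.+1%:R :> R.
Proof.
have n1 : 0 < n.+1%:R :> R by rewrite ltr0n.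
have n2 : 0 < n.+2%:R :> R by rewrite ltr0n.
have -> : ln n.+2%:R - ln n.+1%:R = - ln (1 + - n.+2%:R^-1) :> R.
  rewrite -[RHS]lnV ?posrE; last first.
    by rewrite subr_gt0 invf_lt1// ltr1n.
  rewrite -ln_div ?posrE//; congr ln.
  have -> : 1 - n.+2%:R^-1 = n.+1%:R / n.+2%:R :> R.
    apply: (mulIf (lt0r_neq0 n2)); rewrite mulfVK ?lt0r_neq0//.
    by rewrite mulrBl mul1r mulVf ?lt0r_neq0// -[n.+2]addn1 natrD addrK.
  by rewrite invf_div.
rewrite lerNr; apply: le_ln1Dx; rewrite ltrN2 invf_lt1//.
by rewrite ltr1n.
Qed.

(* The increments of [f] along the path from the root to [v] are at most
   [wnorm f / k], and harmonic sums are at most [1 + ln]. *)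
Lemma Lw_growth (f : Lw R T) v : normc (f v) <= (2 + ln (depth v)%:R) * wnorm f.
Proof.
(* The sharper value 1 at the root leaves room for the increment 1 of the first edge; later
   increments are absorbed by [ln]. The stated bound at the root follows since [ln 0 = 0]. *)
pose L (n : nat) : R := if n is 0 then 1 else 2 + ln n%:R.
suff h : normc (f v) <= L (depth v) * wnorm f.
  rewrite (le_trans h)// ler_wpM2r ?wnorm_ge0// /L.
  by case: (depth v) => //; rewrite ln0// addr0 ler1n.
elim/depth_ind: v => [|v vr IH].
  by rewrite depth_root mul1r lerDl sup_wvdiffs_ge0.
have -> : f v = f (parent v) + (f v - f (parent v)) by rewrite addrC subrK.
apply: le_trans (le_normcD _ _) _.
have dv0 : 0 < (depth v)%:R :> R by rewrite ltr0n depth_gt0.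
have : normc (f v - f (parent v)) <= (depth v)%:R^-1 * wnorm f.
  by rewrite ler_pdivlMl//; exact: wvdiff_le_wnorm.
move=> /(lerD IH) /le_trans; apply; rewrite -mulrDl ler_wpM2r ?wnorm_ge0//.
rewrite (depth_parent vr); case: (depth (parent v)) => [|n] /=.
  by rewrite ln1 invr1 addr0.
by rewrite -addrA lerD2l -lerBrDl; exact: ln_succ_ge.
Qed.

End LwFacts.

(** * Limits along filters and ultrafilters *)

Section Filters.

Lemma filter_finite_forall (I : choiceType) (S : Type) (F : set_system S)
    (FF : Filter F) (D : set I) (P : I -> S -> Prop) :
  finite_set D -> (forall i, D i -> \forall x \near F, P i x) ->
  \forall x \near F, forall i, D i -> P i x.
Proof.
move=> /finite_seqP[s ->]; elim: s => [|a s IH] hs; first exact: nearW.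
have h1 : \forall x \near F, P a x by apply: hs; rewrite /= mem_head.
have h2 : \forall x \near F, forall i, [set` s] i -> P i x.
  by apply: IH => i /= si; apply: hs; rewrite /= inE si orbT.
near=> x => i /=; rewrite inE => /orP[/eqP ->|].
  by near: x.
by move: i; near: x.
Unshelve. all: by end_near. Qed.

(** Compactness of [[-c, c]] gives a cluster point of the image. An ultrafilter contains the
    preimage of each of its neighbourhoods, since the complement would miss that neighbourhood. *)
Lemma ultra_bounded_cvg (R : realType) (S : Type) (F : set_system S)
    (FU : UltraFilter F) (f : S -> R) (c : R) :
  (\forall x \near F, `|f x| <= c) -> exists l : R, f @ F --> l.
Proof.
move=> fc; have fc' : (f @ F) `[- c, c]%classic.
  by apply: filterS fc => x /=; rewrite in_itv/= ler_norml.
have [l [_ cl]] := @segment_compact R (- c) c (f @ F) _ fc'.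
exists l => B lB; have [//|nB] := in_ultra_setVsetC (f @^-1` B) FU.
by have [y [+ By]] := cl (~` B) B nB lB.
Qed.

Lemma ultra_bounded_cvgc (R : realType) (S : Type) (F : set_system S)
    (FU : UltraFilter F) (f : S -> R[i]) (c : R) :
  (\forall x \near F, normc (f x) <= c) ->
  exists l, forall e, 0 < e -> \forall x \near F, normc (l - f x) < e.
Proof.
move=> fc.
have [a /cvgrPdist_lt ha] : exists a : R, (fun x => complex.Re (f x)) @ F --> a.
  apply: (@ultra_bounded_cvg _ _ _ _ _ c).
  by apply: filterS fc => x; apply: le_trans; exact: Re_le_normc.
have [b /cvgrPdist_lt hb] : exists b : R, (fun x => complex.Im (f x)) @ F --> b.
  apply: (@ultra_bounded_cvg _ _ _ _ _ c).
  by apply: filterS fc => x; apply: le_trans; exact: Im_le_normc.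
exists (Complex a b) => e e0; have e2 : 0 < e / 2 by lra.
apply: filterS2 (ha _ e2) (hb _ e2) => x hax hbx.
apply: le_lt_trans (normc_le_ReIm _) _; move: hax hbx.
case: (f x) => /= u v; lra.
Qed.

End Filters.

(** * Compactness of dominated sets of functions *)

Section CompactSets.
Variables (R : realType) (T : rooted_tree).
Implicit Types (f g : T -> R[i]) (v : T).

Lemma wvdiffB f g v : wvdiff (f - g) v <= wvdiff f v + wvdiff g v.
Proof.
rewrite (le_trans (wvdiffD _ _ _))// lerD2l -scaleN1r wvdiffZ.
by rewrite normcN normc1 mul1r.
Qed.

Lemma wvdiff_le f v (a b : R) :
  normc (f v) <= a -> normc (f (parent v)) <= b ->
  wvdiff f v <= (depth v)%:R * (a + b).
Proof.
move=> fa fb; rewrite ler_wpM2l// (le_trans (le_normcD _ _))// lerD//.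
by rewrite normcN.
Qed.

(** The finitely many vertices of small depth only contribute a maximum. *)
Lemma Lw_pred_near f M :
  (\forall v \near at_infty T, wvdiff f v <= M) -> f \in @Lw_pred R T.
Proof.
move=> [n _ hn].
have /finite_seqP[s sE] := finite_depth_le T n.
apply: (@Lw_predP _ _ _ (Num.max M (\big[Num.max/0]_(v <- s) wvdiff f v))) => v.
rewrite le_max; have [nv|/ltnW vn] := leqP n (depth v).
  by rewrite hn.
have sv : v \in s by have : [set` s] v by rewrite -sE.
by apply/orP; right; apply: le_bigmax_seq sv _.
Qed.

Lemma Lw0_predP (f : Lw R T) (e : T -> R) :
  e @ at_infty T --> (0 : R) -> (\forall v \near at_infty T, wvdiff f v <= e v) ->
  f \in @Lw0_pred R T.
Proof.
move=> e0 fe; apply/asboolP; apply: (squeeze_cvgr _ (cvg_cst 0) e0).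
by apply: filterS fe => v ->; rewrite wvdiff_ge0.
Qed.

(** The bound [c] provides a pointwise limit [h] along an ultrafilter, and [h] inherits both bounds.
    Since [e] tends to 0, norm convergence then only has to be checked on a finite ball. *)
Lemma compact_Lw0_dominated (c e : T -> R) : e @ at_infty T --> (0 : R) ->
  compact [set g : Lw0 R T | forall v, normc (g v) <= c v /\ wvdiff g v <= e v].
Proof.
move=> e0; rewrite compact_ultra => F FU FK.
have /choice[h hP] v : exists l : R[i], forall eps, 0 < eps ->
    \forall g \near F, normc (l - (g : Lw0 R T) v) < eps.
  by apply: (@ultra_bounded_cvgc _ _ _ _ _ (c v)); apply: filterS FK => g /(_ v)[].
have hc v : normc (h v) <= c v.
  apply/ler_addgt0Pr => eps eps0.
  have [g [gK hg]] := filter_ex (filterI FK (hP v eps eps0)).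
  rewrite -[h v](subrK (g v)) (le_trans (le_normcD _ _))// addrC lerD//.
    by have [] := gK v.
  exact: ltW.
have he v : wvdiff h v <= e v.
  apply/ler_addgt0Pr => eps eps0.
  (* Chosen so that [depth v * (d + d) <= eps]; the successor keeps the divisor nonzero at the
     root. *)
  pose d := eps / (2 * (depth v).+1%:R).
  have n0 : 0 < (depth v).+1%:R :> R by rewrite ltr0n.
  have d0 : 0 < d by rewrite divr_gt0// mulr_gt0.
  have [g [[gK hg] hgp]] := filter_ex
    (filterI (filterI FK (hP v d d0)) (hP (parent v) d d0)).
  have -> : h = (h - (g : T -> R[i])) + g by rewrite subrK.
  rewrite (le_trans (wvdiffD _ _ _))// addrC lerD//; first by have [] := gK v.
  apply: le_trans (wvdiff_le (ltW hg) (ltW hgp)) _.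
  have -> : eps = (depth v).+1%:R * (d + d).
    by rewrite /d; field; rewrite lt0r_neq0.
  by apply: ler_wpM2r; [lra | rewrite ler_nat].
have hLw : h \in @Lw_pred R T.
  apply: (@Lw_pred_near _ 1).
  move/cvgr0Pnorm_lt: (e0) => /(_ 1 ltr01); apply: filterS => v ev.
  by rewrite (le_trans (he v))// (le_trans (ler_norm _))// ltW.
have hLw0 : MkLw hLw \in @Lw0_pred R T by apply: (Lw0_predP e0); exact: nearW.
exists (MkLw0 hLw0); split => //=.
apply/cvgc_distP => eps eps0.
(* From depth [n] on, [h] and [g] each contribute at most [eps / 4]. Below it, closeness [d] at a
   vertex and its parent gives at most [2 * (n + 1) * d = eps / 2]. The root adds less than
   [d <= eps / 4], so the norm stays below [eps]. *)
have eps4 : 0 < eps / 4 by lra.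
move/cvgr0Pnorm_lt: (e0) => /(_ _ eps4)[n _ hn].
pose d := eps / (4 * n.+1%:R).
have n0 : 0 < n.+1%:R :> R by rewrite ltr0n.
have d0 : 0 < d by rewrite divr_gt0// mulr_gt0.
have dn : d * n.+1%:R = eps / 4 by rewrite /d; field; rewrite lt0r_neq0.
have d4 : d <= eps / 4.
  by rewrite -dn ler_peMr ?(ltW d0)// ler1n.
have hD : \forall g \near F, forall v, [set v : T | (depth v <= n)%N] v ->
    normc (h v - (g : Lw0 R T) v) < d.
  by apply: filter_finite_forall; [exact: finite_depth_le | move=> v _; exact: hP].
apply: filterS2 FK hD => g gK gD.
rewrite Lw0_normE Lw_normE ltcR.
suff : sup (wvdiffs (h - (g : T -> R[i]))) <= eps / 2.
  have := gD root; rewrite /= depth_root => /(_ isT).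
  rewrite /wnorm /= => h1 h2.
  by apply: (le_lt_trans (lerD (ltW h1) h2)); lra.
apply: sup_wvdiffs_le => v.
have [nv|vn] := leqP n (depth v).
  have [_ h1] := gK v; have h2 : `|e v| < eps / 4 := hn v nv.
  apply: le_trans (wvdiffB h g v) _.
  by move: (he v) (ler_norm (e v)); lra.
have [->|vr] := eqVneq v root; first by rewrite wvdiff_root; lra.
have hpv : (depth (parent v) <= n)%N.
  by rewrite -ltnS -depth_parent// leqW// ltnW.
apply: le_trans (wvdiff_le (ltW (gD v (ltnW vn))) (ltW (gD _ hpv))) _.
have : (depth v)%:R * d <= n.+1%:R * d 
  by apply: ler_wpM2r; [exact: ltW | rewrite ler_nat leqW// ltnW].
by rewrite mulrDr; lra.
Qed.

End CompactSets.

(** * Logarithms of naturals, and bounded sets in terms of the real norm *)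

Lemma ln_nat_ge0 (R : realType) (n : nat) : 0 <= ln n%:R :> R.
Proof. by case: n => [|n]; [rewrite ln0 | rewrite ln_ge0// ler1n]. Qed.

Lemma bounded_wnorm (R : realType) (T : rooted_tree) (A : set (Lw R T)) :
  bounded_set A -> exists m : R, forall f, A f -> wnorm f <= m.
Proof.
(* [bounded_set] only promises bounds strictly above [M], hence the [+ 1]. *)
move=> [M [Mr AM]]; exists (complex.Re (`|M| + 1)) => f Af.
have : M < `|M| + 1 by rewrite (le_lt_trans (real_ler_norm Mr))// ltrDl.
by move=> /AM/(_ _ Af); rewrite /= Lw_normE lecE => /andP[].
Qed.

Lemma wnorm_bounded (R : realType) (T : rooted_tree) (A : set (Lw R T)) (m : R) :
  (forall f, A f -> wnorm f <= m) -> bounded_set A.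
Proof.
move=> Am; exists m%:C; split; first by rewrite complex_real.
move=> M mM f Af; rewrite /= (le_trans _ (ltW mM))// Lw_normE lecR; exact: Am.
Qed.

(** * Sufficiency of (c) *)

Section Multiplication.
Variables (R : realType) (T : rooted_tree) (psi : T -> R[i]).
Implicit Types (v : T).

Definition mult_weight v : R :=
  normc (psi (parent v)) + (depth v)%:R * (2 + ln (depth v)%:R) * vdiff psi v.

(** Discrete product rule with [psi] taken at the parent and [f] at [v]; the growth bound controls
    [f v]. *)
Lemma wvdiff_mult (f : Lw R T) v :
  wvdiff (fun w => psi w * f w) v <= mult_weight v * wnorm f.
Proof.
have dE : psi v * f v - psi (parent v) * f (parent v) =
    psi (parent v) * (f v - f (parent v)) + (psi v - psi (parent v)) * f v.
  by ring.
rewrite /wvdiff /vdiff dE.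
apply: le_trans (ler_wpM2l _ (le_normcD _ _)) _ => //.
rewrite !normcM mulrDr /mult_weight mulrDl lerD//.
  rewrite mulrCA ler_wpM2l ?normc_ge0//; exact: wvdiff_le_wnorm.
rewrite -!mulrA ler_wpM2l// [leRHS]mulrCA.
by rewrite ler_wpM2l ?normc_ge0// Lw_growth.
Qed.

(** Once [ln |v| >= 1], one has [2 + ln |v| <= 3 * ln |v|], so the weight is squeezed by the two
    quantities in (c). *)
Lemma mult_weight_cvg :
  psi v @[v --> at_infty T] --> (0 : R[i]) ->
  (depth v)%:R * ln (depth v)%:R * vdiff psi v @[v --> at_infty T] --> (0 : R) ->
  mult_weight @ at_infty T --> (0 : R).
Proof.
move=> /cvg_normc psi0 dpsi0.
have h0 : normc (psi (parent v)) +
    3 * ((depth v)%:R * ln (depth v)%:R * vdiff psi v)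
    @[v --> at_infty T] --> (0 : R).
  rewrite -[0 in X in _ --> X](addr0 0) -[0 in X in _ --> X + _]addr0.
  rewrite -[X in _ --> _ + X](mulr0 3) addr0.
  apply: cvgD; last by apply: cvgM dpsi0; exact: cvg_cst.
  by move=> B /psi0; exact: at_infty_parent.
apply: (squeeze_cvgr _ (cvg_cst 0) h0).
have [n en] : exists n, expR 1 <= n%:R :> R.
  by exists (Num.bound (expR 1 : R)); exact/ltW/archi_boundP/expR_ge0.
apply: filterS (at_infty_depth T n) => v nv.
have ln1 : 1 <= ln (depth v)%:R :> R.
  rewrite -[leLHS](@expRK R) ler_ln ?posrE ?expR_gt0//.
    by rewrite (le_trans en)// ler_nat.
  by rewrite (lt_le_trans (expR_gt0 1))// (le_trans en)// ler_nat.
rewrite /mult_weight lerD2l; apply/andP; split.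
  by rewrite addr_ge0 ?normc_ge0// !mulr_ge0 ?normc_ge0//; lra.
rewrite !mulrA ler_wpM2r ?normc_ge0// [3 * _]mulrC -mulrA ler_wpM2l//; lra.
Qed.

(** With domain [Lw] and codomain [Lw0], composing with the inclusion on one side or the other gives
    the operators of (a) and (b). *)
Lemma compact_mult_operator :
  mult_weight @ at_infty T --> (0 : R) ->
  exists2 B : {linear Lw R T -> Lw0 R T},
    (forall f v, B f v = psi v * f v) & compact_operator B.
Proof.
move=> w0.
have wf0 (f : Lw R T) : mult_weight v * wnorm f @[v --> at_infty T] --> (0 : R).
  by rewrite -(mul0r (wnorm f)); apply: cvgM w0 _; exact: cvg_cst.
have inLw (f : Lw R T) : (fun w => psi w * f w) \in @Lw_pred R T.
  apply: (@Lw_pred_near _ _ _ 1).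
  move/cvgr0Pnorm_lt: (wf0 f) => /(_ 1 ltr01); apply: filterS => v ev.
  by rewrite (le_trans (wvdiff_mult f v))// (le_trans (ler_norm _))// ltW.
have inLw0 (f : Lw R T) : MkLw (inLw f) \in @Lw0_pred R T.
  by apply: (Lw0_predP (wf0 f)); apply: nearW => v; exact: wvdiff_mult.
pose B f := MkLw0 (inLw0 f).
have Blin : linear B.
  move=> a f g; apply/val_inj/val_inj/funext => v /=.
  by rewrite mulrDr mulrCA.
pose Bl : {linear Lw R T -> Lw0 R T} :=
  HB.pack B (GRing.isLinear.Build _ _ _ _ B Blin).
exists Bl => // A /bounded_wnorm[m Am].
(* [K] contains the image of the ball of radius [m], by the growth bound and the product rule. *)
pose K := [set g : Lw0 R T | forall v,
  normc (g v) <= normc (psi v) * ((2 + ln (depth v)%:R) * m) /\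
  wvdiff g v <= mult_weight v * m].
have cK : compact K.
  apply: compact_Lw0_dominated.
  by rewrite -(mul0r m); apply: cvgM w0 _; exact: cvg_cst.
have pK : precompact K.
  by rewrite precompact_closed//; apply: compact_closed cK; exact: norm_hausdorff.
apply: precompact_subset pK => _ [f Af <-] v; split.
  rewrite /= normcM ler_wpM2l ?normc_ge0// (le_trans (Lw_growth f v))//.
  by rewrite ler_wpM2l ?addr_ge0 ?ln_nat_ge0// Am.
rewrite (le_trans (wvdiff_mult f v))// ler_wpM2l ?Am//.
by rewrite addr_ge0 ?mulr_ge0 ?normc_ge0 ?addr_ge0 ?ln_nat_ge0.
Qed.

End Multiplication.

(** * Necessity of (c) *)

Section Necessity.
Variables (R : realType) (T : rooted_tree) (psi : T -> R[i]).
Variable C : {linear Lw0 R T -> Lw R T}.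
Hypothesis C_mult : forall f v, C f v = psi v * f v.
Hypothesis C_compact : compact_operator C.
Implicit Types v w : T.

(** Otherwise compactness gives a cluster point [p] of images with norm at least [e]. The images
    tend to 0 at each vertex, so [p = 0], and some of them are closer to 0 than [e]. *)
Lemma compact_mult_null (f : T -> Lw0 R T) (M : R) :
  (forall v, wnorm (f v) <= M) ->
  (forall w, normc (f v w) @[v --> at_infty T] --> (0 : R)) ->
  wnorm (C (f v)) @[v --> at_infty T] --> (0 : R).
Proof.
move=> fM f0; apply/cvgr0Pnorm_lt => e e0; apply: contrapT => not_lt.
(* [G] is proper exactly because the norms are not eventually below [e]. *)
pose G := within [set v | e <= wnorm (C (f v))] (at_infty T).
have GP : ProperFilter G.
  split; last exact: within_filter.
  move=> G0; apply: not_lt.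
  have {}G0 : \forall v \near at_infty T, e <= wnorm (C (f v)) -> False by [].
  apply: filterS G0 => v /= h.
  by rewrite ger0_norm ?wnorm_ge0// ltNge; apply/negP => /h.
have [K rK [cK _]] : precompact (C @` range f).
  apply: C_compact; have [M0 [M0r h]] : bounded_set [set Lw0_val g | g in range f].
    by apply: wnorm_bounded => _ [_ [v _ <-] <-]; exact: fM.
  by exists M0; split=> // x /h hx g gf; apply: hx; exists g.
have [p [_ pcl]] : K `&` cluster ((fun v => C (f v)) @ G) !=set0.
  apply: cK; apply: nearW => v _.
  by apply: rK; exists (f v) => //; exists v.
have ballp (d : R) : 0 < d -> nbhs p [set h | `|p - h| < d%:C].
  move=> d0; apply/nbhs_ballP; exists d%:C; first by rewrite /= ltcR.
  by rewrite -ball_normE.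
have p0 w : normc (p w) <= 0.
  apply/ler_addgt0Pl => eps eps0.
  (* By the growth bound, evaluation at [w] has norm at most [L]; being within [d] of [p] in norm
     costs at most [L * d = eps / 2] at [w]. *)
  pose L : R := 2 + ln (depth w)%:R.
  have L0 : 0 < L by rewrite /L ltr_wpDr// ln_nat_ge0.
  pose d := eps / 2 / L.
  have d0 : 0 < d by rewrite !divr_gt0.
  have small : ((fun v => C (f v)) @ G) [set h | normc (h w) < eps / 2].
    have : (fun v => normc (psi w) * normc (f v w)) @ at_infty T --> (0 : R).
      by rewrite -(mulr0 (normc (psi w))); apply: cvgM; [exact: cvg_cst|].
    have e20 : 0 < eps / 2 by rewrite divr_gt0.
    move/cvgr0Pnorm_lt => /(_ _ e20); apply: filterS => v hv _ /=.
    by rewrite C_mult normcM (le_lt_trans (ler_norm _)).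
  have [h [hw]] := pcl _ _ small (ballp d d0).
  rewrite /= Lw_normE ltcR => hd.
  rewrite addr0 -[p w](subrK (h w)) (le_trans (le_normcD _ _))//.
  have pL : normc (p w - h w) <= L * d.
    apply: le_trans (Lw_growth (p - h) w) _.
    by rewrite ler_wpM2l; [|exact: ltW|exact: ltW].
  have dE : L * d = eps / 2 by rewrite /d mulrC divfK ?lt0r_neq0.
  by rewrite [leRHS]splitr lerD ?(ltW hw)// -dE.
have p00 : p = 0.
  apply/val_inj/funext => w; apply: eq0_normc; apply/eqP.
  by rewrite eq_le p0 normc_ge0.
have big : ((fun v => C (f v)) @ G) [set h | e <= wnorm h] by exact: nearW.
have [h [/= eh]] := pcl _ _ big (ballp e e0).
by rewrite p00 sub0r normrN Lw_normE ltcR ltNge eh.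
Qed.

(** Each [f v] has vanishing differences beyond depth [n v], so it lies in [Lw0], with norm at most
    [2 * M]. The conclusion evaluates the image of [f v] at the single vertex [v]. *)
Lemma compact_mult_test (f : T -> T -> R[i]) (M : R) (n : T -> nat) :
  (forall v, normc (f v root) <= M) ->
  (forall v w, wvdiff (f v) w <= M) ->
  (forall v w, (n v < depth w)%N -> wvdiff (f v) w = 0) ->
  (forall w, normc (f v w) @[v --> at_infty T] --> (0 : R)) ->
  wvdiff (fun w => psi w * f v w) v @[v --> at_infty T] --> (0 : R).
Proof.
move=> fr fM fn f0.
have /choice[g gP] v : exists g : Lw0 R T, Lw_val (Lw0_val g) = f v.
  have fLw := Lw_predP (fM v).
  have fLw0 : MkLw fLw \in @Lw0_pred R T.
    apply: (@Lw0_predP _ _ _ (fun=> 0)); first exact: cvg_cst.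
    by apply: filterS (at_infty_depth T (n v).+1) => w /fn ->.
  by exists (MkLw0 fLw0).
have : wnorm (C (g v)) @[v --> at_infty T] --> (0 : R).
  apply: (@compact_mult_null _ (M + M)) => [v|w].
    by rewrite /wnorm gP lerD//; exact: sup_wvdiffs_le.
  by under eq_fun do rewrite gP; exact: f0.
apply: squeeze_cvgr; last exact: cvg_cst; apply: nearW => v.
rewrite wvdiff_ge0/= (_ : (fun w => _) = C (g v)) ?wvdiff_le_wnorm//.
by apply/funext => w; rewrite C_mult gP.
Qed.

Lemma compact_mult_symbol0 : psi v @[v --> at_infty T] --> (0 : R[i]).
Proof.
(* The indicator of [v] also has nonzero differences at the children of [v], at depth [|v| + 1];
   this scaling bounds them by 1. *)
pose a v : R := (depth v).+1%:R^-1.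
have a0 v : 0 <= a v by rewrite invr_ge0.
have na v : normc (a v)%:C = a v by rewrite normc_real ger0_norm.
have ad v : (depth v).+1%:R * a v = 1 by rewrite mulfV// pnatr_eq0.
pose f v w : R[i] := if w == v then (a v)%:C else 0.
have f1 v w : normc (f v w) <= a v.
  by rewrite /f; case: ifP => _; rewrite ?na ?normc0.
have a1 v : a v <= 1 by rewrite invf_le1 ?ler1n ?ltr0n.
have fne v w : w != v -> f v w = 0 by rewrite /f => /negPf ->.
have : wvdiff (fun w => psi w * f v w) v @[v --> at_infty T] --> (0 : R).
  apply: (@compact_mult_test f 1 (fun v => (depth v).+1)) => [v|v w|v w vw|w].
  - exact: le_trans (f1 v root) (a1 v).
  - have [->|wr] := eqVneq w root; first by rewrite wvdiff_root.
    have [->|wv] := eqVneq w v.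
      have [->|vr] := eqVneq v root; first by rewrite wvdiff_root.
      apply: (le_trans (wvdiff_le (f1 v v) (_ : _ <= 0))).
        by rewrite fne ?parent_neq// normc0.
      by rewrite addr0 -[leRHS](ad v) ler_wpM2r// ler_nat.
    have [pv|pv] := eqVneq (parent w) v.
      apply: (le_trans (wvdiff_le (_ : _ <= 0) (f1 v (parent w)))).
        by rewrite fne// normc0.
      by rewrite add0r -[leRHS](ad v) depth_parent// pv.
    by rewrite /wvdiff /vdiff !fne// subrr normc0 mulr0.
  - have wr : w != root by rewrite -depth_gt0 (leq_trans _ vw).
    have wv : w != v by apply: contraTneq vw => ->; rewrite ltnNge leqnSn.
    have pv : parent w != v.
      by apply: contraTneq vw => <-; rewrite -depth_parent// ltnn.
    by rewrite /wvdiff /vdiff !fne// subrr normc0 mulr0.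
  - apply: cvg_near_cst; apply: filterS (at_infty_depth T (depth w).+1) => v.
    by move=> vw; rewrite fne ?normc0//; apply: contraTneq vw => ->; rewrite ltnn.
move=> h; apply/cvg_normc.
(* The factor 2 compensates [|v| / (|v| + 1) >= 1 / 2], valid away from the root. *)
have h2 : 2 * wvdiff (fun w => psi w * f v w) v @[v --> at_infty T] --> (0 : R).
  by rewrite -(mulr0 2); apply: cvgM h; exact: cvg_cst.
apply: (squeeze_cvgr _ (cvg_cst 0) h2).
apply: filterS (at_infty_neq_root T) => v vr; rewrite normc_ge0/=.
rewrite /wvdiff /vdiff (fne v (parent v)) ?parent_neq// mulr0 subr0 /f eqxx.
rewrite normcM na mulrCA [normc _ * _]mulrC mulrA mulrA ler_peMl ?normc_ge0//.
have : (depth v)%:R * a v + a v = 1 by rewrite -[RHS](ad v) -natr1 mulrDl mul1r.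
suff : a v <= (depth v)%:R * a v by lra.
by rewrite ler_peMl// ler1n depth_gt0.
Qed.

(* [h N n = ln(min(n, N))^2 / ln N] satisfies [h N N = ln N] while
   [n * (h N n - h N (n - 1)) <= 4] and [h N n -> 0] as [N -> oo]. *)
Let h (N n : nat) : R := ln (minn n N)%:R ^+ 2 / ln N%:R.

Let hNN N : h N N = ln N%:R.
Proof.
(* If [ln N = 0], both sides vanish because division by 0 yields 0. *)
rewrite /h minnn; have [->|N0] := eqVneq (ln N%:R : R) 0.
  by rewrite invr0 mulr0.
by rewrite expr2 mulfK.
Qed.

Let h_incr N n : n.+1%:R * `|h N n.+1 - h N n| <= 4.
Proof.
have [Nn|nN] := leqP N n.
  by rewrite /h (minn_idPr Nn) (minn_idPr (leqW Nn)) subrr normr0 mulr0.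
rewrite /h (minn_idPl nN) (minn_idPl (ltnW nN)).
(* At [n = 0] both logarithms are 0, that of 0 by convention. *)
case: n nN => [|k] kN; first by rewrite ln1 (ln0 (lexx 0)) subrr normr0 mulr0.
have k1 : 0 < k.+1%:R :> R by rewrite ltr0n.
have k2 : 0 < k.+2%:R :> R by rewrite ltr0n.
have N0 : 0 < N%:R :> R by rewrite ltr0n (leq_trans _ kN).
have lnN0 : 0 < ln N%:R :> R by rewrite ln_gt0// ltr1n (leq_trans _ kN).
have lnk : ln k.+1%:R <= ln k.+2%:R :> R by rewrite ler_ln ?posrE// ler_nat.
have lnkN : ln k.+2%:R <= ln N%:R :> R by rewrite ler_ln ?posrE// ler_nat.
have lnd : ln k.+2%:R - ln k.+1%:R <= k.+1%:R^-1 :> R.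
  have -> : ln k.+2%:R - ln k.+1%:R = ln (1 + k.+1%:R^-1) :> R.
    rewrite -ln_div ?posrE//; congr ln.
    by rewrite -[k.+2%:R]natr1 mulrDl mulfV ?lt0r_neq0// mul1r.
  by apply: le_ln1Dx; rewrite (lt_trans (ltrN10 R))// invr_gt0.
have lnk0 := ln_nat_ge0 R k.+1.
(* Factor the difference of squares. [k + 2] times the difference of logarithms is at most
   [(k + 2) / (k + 1) <= 2], and their sum over [ln N] is at most 2. *)
rewrite -mulrBl subr_sqr ger0_norm; last first.
  by rewrite divr_ge0 ?mulr_ge0 ?subr_ge0 ?addr_ge0 ?ln_nat_ge0.
rewrite -[(_ - _) * _ / _]mulrA [leLHS]mulrA -[leRHS](_ : 2 * 2 = _); last by lra.
apply: ler_pM.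
- by rewrite mulr_ge0// subr_ge0.
- by rewrite divr_ge0 ?addr_ge0 ?ln_nat_ge0.
- apply: le_trans (ler_wpM2l _ lnd) _ => //.
  by rewrite ler_pdivrMr// -natrM ler_nat; lia.
- by rewrite ler_pdivrMr//; lra.
Qed.

(** The test function equals [ln |v|] at [v], so the product rule, solved for the term in
    [vdiff psi v], leaves an error of at most [4 * |psi (v^-)|], which tends to 0 by the first half
    of (c). *)
Lemma compact_mult_log_diff0 :
  (depth v)%:R * ln (depth v)%:R * vdiff psi v @[v --> at_infty T] --> (0 : R).
Proof.
pose f v w : R[i] := (h (depth v) (depth w))%:C.
have fd v w : w != root ->
    wvdiff (f v) w = (depth (parent w)).+1%:R *
      `|h (depth v) (depth (parent w)).+1 - h (depth v) (depth (parent w))|.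
  by move=> wr; rewrite /wvdiff /vdiff /f -rmorphB normc_real depth_parent.
have f4 v w : wvdiff (f v) w <= 4.
  have [->|wr] := eqVneq w root; first by rewrite wvdiff_root.
  by rewrite fd// h_incr.
have : wvdiff (fun w => psi w * f v w) v @[v --> at_infty T] --> (0 : R).
  apply: (@compact_mult_test f 4 (fun v => depth v)) => // [v|v w vw|w].
  - by rewrite /f depth_root /h min0n ln0// expr0n mul0r normc0.
  - have wr : w != root by rewrite -depth_gt0 (leq_trans _ vw).
    have vp : (depth v <= depth (parent w))%N by rewrite -ltnS -depth_parent.
    by rewrite fd// /h (minn_idPr vp) (minn_idPr (leqW vp)) subrr normr0 mulr0.
  - apply/cvgr0Pnorm_lt => e e0.
    (* For [|v| >= |w|], the value at [w] is below [e] as soon as [ln |v| > x]; the [+ 1] in [n]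
       makes this strict. *)
    pose x := ln (depth w)%:R ^+ 2 / e.
    have x0 : 0 <= x by rewrite divr_ge0 ?sqr_ge0 ?ltW.
    pose n := Num.bound (expR (x + 1)).
    have en : expR (x + 1) < n%:R by apply: archi_boundP; exact: expR_ge0.
    apply: filterS (at_infty_depth T (maxn (depth w) n)) => v.
    rewrite geq_max => /andP[wv nv].
    have xln : x < ln (depth v)%:R.
      rewrite (@lt_le_trans _ _ (x + 1)) ?ltrDl// -[leLHS]expRK ler_ln ?posrE.
      + by rewrite (le_trans (ltW en))// ler_nat.
      + exact: expR_gt0.
      + by rewrite (lt_le_trans (expR_gt0 (x + 1)))// (le_trans (ltW en))// ler_nat.
    have ln0 : 0 < ln (depth v)%:R :> R by exact: le_lt_trans xln.
    rewrite /f /h (minn_idPl wv) normc_real normr_id ger0_norm; last first.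
      by rewrite divr_ge0 ?sqr_ge0 ?ltW.
    by rewrite ltr_pdivrMr// mulrC -ltr_pdivrMr.
move=> h0.
have h1 : wvdiff (fun w => psi w * f v w) v + normc (psi (parent v)) * 4
    @[v --> at_infty T] --> (0 : R).
  rewrite -[0 in X in _ --> X](addr0 0) -[0 in X in _ --> _ + X](mul0r 4).
  apply: cvgD h0 _; apply: cvgM; last exact: cvg_cst.
  move/cvg_normc: compact_mult_symbol0 => psi0 B /psi0; exact: at_infty_parent.
apply: (squeeze_cvgr _ (cvg_cst 0) h1); apply: nearW => v.
rewrite !mulr_ge0 ?normc_ge0 ?ln_nat_ge0//=.
have -> : (depth v)%:R * ln (depth v)%:R * vdiff psi v =
    (depth v)%:R * normc ((psi v - psi (parent v)) * f v v).
  rewrite normcM /f hNN normc_real ger0_norm ?ln_nat_ge0//.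
  by rewrite -mulrA [ln _ * _]mulrC.
have -> : (psi v - psi (parent v)) * f v v =
    (psi v * f v v - psi (parent v) * f v (parent v)) -
    psi (parent v) * (f v v - f v (parent v)) by ring.
apply: le_trans (ler_wpM2l _ (le_normcD _ _)) _ => //.
rewrite mulrDr lerD2l normcN normcM mulrCA ler_wpM2l ?normc_ge0//.
exact: f4.
Qed.

End Necessity.

(** * Composing compact operators with isometries *)

Section IsometricComposition.
Variables (K : numFieldType) (X Y Z : normedModType K).

Lemma compact_operator_comp_isometry (J : {linear X -> Y}) (A : {linear Y -> Z}) :
  (forall x, `|J x| = `|x|) -> compact_operator A -> compact_operator (A \o J).
Proof.
move=> Jn cA B [M [Mr BM]]; rewrite -image_comp; apply: cA.
by exists M; split=> // N /BM BN _ [x Bx <-]; rewrite /= Jn; exact: BN.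
Qed.

Lemma compact_operator_isometry_comp (A : {linear X -> Y}) (J : {linear Y -> Z}) :
  (forall y, `|J y| = `|y|) -> compact_operator A -> compact_operator (J \o A).
Proof.
move=> Jn cA B bB; rewrite -image_comp; have [U BU [cU _]] := cA B bB.
have Jc : continuous J.
  move=> y; apply/cvgrPdist_lt => e e0; apply/nbhs_ballP; exists e => // z.
  by rewrite -ball_normE /= -raddfB Jn.
have cJU : compact (J @` U).
  by apply: continuous_compact cU; exact: continuous_subspaceT.
exists (J @` U); first by move=> _ [y By <-]; exists y => //; exact: BU.
by split=> //; apply: compact_closed cJU; exact: norm_hausdorff.
Qed.

End IsometricComposition.

(** * Equivalence of (a), (b) and (c) *)

Theorem theorem7p2 (R : realType) (T : rooted_tree) (psi : T -> R[i])
    (hpsi : mult_bounded_Lw psi) :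
  (mult_compact_Lw psi <-> mult_compact_Lw0 psi) /\
  (mult_compact_Lw0 psi <->
    psi v @[v --> at_infty T] --> (0 : R[i]) /\
    (depth v)%:R * ln (depth v)%:R * vdiff psi v @[v --> at_infty T]
      --> (0 : R)).
Proof.
(* The isometric inclusion: (a) and (b) supply a compact [Lw0 -> Lw] as [A \o J] and [J \o A]
   respectively. *)
pose J : {linear Lw0 R T -> Lw R T} := val.
have Jn f : `|J f| = `|f| by [].
set c := (X in _ /\ (_ <-> X)).
have nec (C : {linear Lw0 R T -> Lw R T}) :
    (forall f v, C f v = psi v * f v) -> compact_operator C -> c.
  move=> CM Cc; split; first exact: (compact_mult_symbol0 CM Cc).
  exact: (compact_mult_log_diff0 CM Cc).
have ac : mult_compact_Lw psi -> c.
  move=> [A AM Ac]; apply: (nec (A \o J)); first by move=> f v; exact: AM.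
  exact: compact_operator_comp_isometry.
have bc : mult_compact_Lw0 psi -> c.
  move=> [A AM Ac]; apply: (nec (J \o A)); first by move=> f v; exact: AM.
  exact: compact_operator_isometry_comp.
have ca : c -> mult_compact_Lw psi.
  move=> [psi0 dpsi0].
  have [B BM Bc] := compact_mult_operator (mult_weight_cvg psi0 dpsi0).
  exists (J \o B); first by move=> f v; exact: BM.
  exact: compact_operator_isometry_comp.
have cb : c -> mult_compact_Lw0 psi.
  move=> [psi0 dpsi0].
  have [B BM Bc] := compact_mult_operator (mult_weight_cvg psi0 dpsi0).
  exists (B \o J); first by move=> f v; exact: BM.
  exact: compact_operator_comp_isometry.
by split; split; [move=> /ac | move=> /bc | exact: bc | exact: cb].
Qed.
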